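(* The permutation pattern matching problem (PPM) is polynomial time reducible to the set partition pattern matching problem (SPPM). That is, there is a polynomial-time computable map sending any pair of permutations $(\pi,\tau)$ to a pair of set partitions $(\sigma,\sigma')$ such that $\pi$ contains $\tau$ if and only if $\sigma$ contains $\sigma'$.
   Context: A permutation $\pi=\pi_1\dots\pi_n$ of $[n]=\{1,\dots,n\}$ contains a permutation $\tau=\tau_1\dots\tau_k$ if there exist indices $i_1<\dots<i_k$ such that for all $j,j'$, $\pi_{i_j}<\pi_{i_{j'}}$ if and only if $\tau_j<\tau_{j'}$. PPM is the problem: given permutations $\pi$ and $\tau$, decide whether $\pi$ contains $\tau$. A set partition of $[n]$ is an unordered collection of nonempty pairwise disjoint blocks whose union is $[n]$. For $T\subseteq[n]$, the standardization map $\mathrm{st}:T\to[\#T]$ sends the $i$-th smallest element of $T$ to $i$. For a partition $\sigma=\{B_1,\dots,B_m\}$ of $[n]$ and $T\subseteq[n]$, $\sigma\cap T$ is the partition of $[\#T]$ whose blocks are the nonempty sets $\mathrm{st}(B_i\cap T)$. A partition $\sigma$ of $[n]$ contains a partition $\sigma'$ of $[k]$ if there is $T\subseteq[n]$ with $\sigma\cap T=\sigma'$. SPPM is the problem: given set partitions $\sigma$ and $\sigma'$, decide whether $\sigma$ contains $\sigma'$. *)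

(* Defs.v *)
From HB Require Import structures.
From Corelib Require Import PosDef.
From mathcomp Require Import all_boot all_order all_algebra all_fingroup.

Set Implicit Arguments.
Unset Strict Implicit.
Unset Printing Implicit Defensive.

(* [n] = {1, ..., n} is rendered by 'I_n = {0, ..., n-1} throughout.          *)

Record permutation := Permutation {
  perm_size : nat;
  perm_fun : 'S_perm_size
}.

Definition perm_contains (pi tau : permutation) : Prop :=
  exists i : 'I_(perm_size tau) -> 'I_(perm_size pi),
    (forall j j' : 'I_(perm_size tau), j < j' -> i j < i j') /\
    (forall j j' : 'I_(perm_size tau),
       perm_fun pi (i j) < perm_fun pi (i j') <->
       perm_fun tau j < perm_fun tau j').

Record set_partition := SetPartition {
  part_size : nat;
  part_blocks : {set {set 'I_part_size}};
  part_blocksP : partition part_blocks [set: 'I_part_size]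
}.

(* [enum T] lists T increasingly, so this is the rank of x among T.           *)
Definition st n (T : {set 'I_n}) (x : {x : 'I_n | x \in T}) : 'I_#|T| :=
  enum_rank_in (valP x) (val x).

Definition st_trace n (T B : {set 'I_n}) : {set 'I_#|T|} :=
  [set @st n T x | x in [pred x : {x : 'I_n | x \in T} | val x \in B]].

Definition restrict_blocks n (P : {set {set 'I_n}}) (T : {set 'I_n}) :
    {set {set 'I_#|T|}} :=
  [set st_trace T B | B in P] :\ set0.

Lemma mem_st_trace n (T B : {set 'I_n}) (i : 'I_#|T|) :
  (i \in st_trace T B) = (enum_val i \in B).
Proof.
apply/imsetP/idP => [[[x xT] xB ->]|iB].
  by rewrite /st enum_rankK_in.
exists (exist _ (enum_val i) (enum_valP i)) => //.
by rewrite /st enum_valK_in.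
Qed.

Lemma restrict_blocksP n (P : {set {set 'I_n}}) (T : {set 'I_n}) :
  partition P [set: 'I_n] ->
  partition (restrict_blocks P T) [set: 'I_#|T|].
Proof.
case/and3P=> /eqP covP /trivIsetP tiP _; apply/and3P; split.
- rewrite eqEsubset subsetT; apply/subsetP => i _.
  have : enum_val i \in cover P by rewrite covP inE.
  case/bigcupP=> B BP iB; apply/bigcupP; exists (st_trace T B).
    rewrite !inE imset_f // andbT; apply/set0Pn; exists i.
    by rewrite mem_st_trace.
  by rewrite mem_st_trace.
- apply/trivIsetP => _ _ /setD1P[_ /imsetP[A AP ->]] /setD1P[_ /imsetP[B BP ->]].
  case: (eqVneq A B) => [-> /eqP //|neAB _].
  rewrite -setI_eq0; apply/eqP/setP => i; rewrite !inE !mem_st_trace.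
  have := tiP A B AP BP neAB; rewrite -setI_eq0 => /eqP/setP/(_ (enum_val i)).
  by rewrite !inE.
- by rewrite !inE eqxx.
Qed.

Definition restrict (s : set_partition) (T : {set 'I_(part_size s)}) :
    set_partition :=
  SetPartition (restrict_blocksP T (part_blocksP s)).

Definition part_contains (s s' : set_partition) : Prop :=
  exists T : {set 'I_(part_size s)}, restrict T = s'.

Inductive direction := MoveLeft | MoveRight | Stay.

(* A two-way infinite tape; tape_left is listed from the head outwards, and   *)
(* every cell beyond the two lists is blank.                                  *)
Record tape (G : Type) := Tape {
  tape_left : seq G;
  tape_head : G;
  tape_right : seq G
}.

Definition tape_word (G : Type) (t : tape G) : seq G :=
  rev (tape_left t) ++ tape_head t :: tape_right t.

Definition tape_update (G : Type) (blank : G) (t : tape G) (a : G * direction) :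
    tape G :=
  let: (x, d) := a in
  match d with
  | Stay => Tape (tape_left t) x (tape_right t)
  | MoveLeft => Tape (behead (tape_left t)) (head blank (tape_left t))
                     (x :: tape_right t)
  | MoveRight => Tape (x :: tape_left t) (head blank (tape_right t))
                      (behead (tape_right t))
  end.

(* A tape cell holds a letter of the input/output alphabet S, a letter of the *)
(* auxiliary alphabet W, or the blank None.                                   *)
Definition cell (S W : finType) : finType := option (S + W).

Record machine (S : finType) := Machine {
  mach_aux : finType;
  mach_tapes : nat;  (* one less than the number of tapes *)
  mach_state : finType;
  mach_start : mach_state;
  mach_halt : pred mach_state;
  mach_delta :
    mach_state -> {ffun 'I_mach_tapes.+1 -> cell S mach_aux} ->
    mach_state * {ffun 'I_mach_tapes.+1 -> cell S mach_aux * direction}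
}.

Section Runs.
Variables (S : finType) (M : machine S).

Let G := cell S (mach_aux M).
Let I := 'I_(mach_tapes M).+1.

Record config := Config {
  conf_state : mach_state M;
  conf_tapes : I -> tape G
}.

Definition letter (a : S) : G := Some (inl a).

Definition blank_tape : tape G := Tape [::] None [::].

Definition input_tape (w : seq S) : tape G :=
  if w is a :: w' then Tape [::] (letter a) (map letter w') else blank_tape.

Definition init_config (w : seq S) : config :=
  Config (mach_start M)
         (fun i : I => if i == ord0 then input_tape w else blank_tape).

Definition step (c : config) : config :=
  if mach_halt (conf_state c) then c else
  let: (q, act) :=
    mach_delta (conf_state c) [ffun i => tape_head (conf_tapes c i)] in
  Config q (fun i => tape_update None (conf_tapes c i) (act i)).

(* The output is what is written on the last tape, up to surrounding blanks.  *)
Definition halts_with (w out : seq S) (t : nat) : Prop :=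
  let c := iter t step (init_config w) in
  mach_halt (conf_state c) /\
  exists a b, tape_word (conf_tapes c ord_max) =
              nseq a None ++ map letter out ++ nseq b None.

End Runs.

Definition poly_time_computable (S : finType) (X Y : Type)
    (encX : X -> seq S) (encY : Y -> seq S) (f : X -> Y) : Prop :=
  exists (M : machine S) (p : {poly nat}), forall x : X,
  exists t : nat, t <= (p.[size (encX x)])%R /\
                  halts_with M (encX x) (encY (f x)) t.

Inductive sym := Bit of bool | EndNumber | EndBlock | Separator.

Definition sym_code (a : sym) : option (option (option bool)) :=
  match a with
  | Bit b => Some (Some (Some b))
  | EndNumber => Some (Some None)
  | EndBlock => Some None
  | Separator => None
  end.

Definition sym_decode (x : option (option (option bool))) : sym :=
  match x with
  | Some (Some (Some b)) => Bit b
  | Some (Some None) => EndNumber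
  | Some None => EndBlock
  | None => Separator
  end.

Lemma sym_codeK : cancel sym_code sym_decode. Proof. by case. Qed.

HB.instance Definition _ := Finite.copy sym (can_type sym_codeK).

(* Binary expansion, least significant bit first.                             *)
Fixpoint pos_bits (p : positive) : seq bool :=
  match p with
  | xH => [:: true]
  | xO p' => false :: pos_bits p'
  | xI p' => true :: pos_bits p'
  end.

Definition nat_bits (n : nat) : seq bool :=
  if bin_of_nat n is Npos p then pos_bits p else [::].

Definition enc_nat (n : nat) : seq sym :=
  rcons (map Bit (nat_bits n)) EndNumber.

(* i : 'I_n stands for the element i + 1 of [n]. *)
Definition enc_ords n (s : seq 'I_n) : seq sym :=
  flatten [seq enc_nat i.+1 | i : 'I_n <- s].

Definition enc_perm (pi : permutation) : seq sym :=
  enc_ords [seq perm_fun pi i | i <- enum 'I_(perm_size pi)].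

(* The blocks are listed by increasing minimum, each block increasingly.      *)
Definition enc_part (s : set_partition) : seq sym :=
  let block x := pblock (part_blocks s) x in
  flatten [seq rcons (enc_ords (enum (block x))) EndBlock |
            x <- enum 'I_(part_size s) & [forall y in block x, x <= y]].

Definition enc_pair (X Y : Type) (encX : X -> seq sym) (encY : Y -> seq sym)
    (u : X * Y) : seq sym :=
  encX u.1 ++ Separator :: encY u.2.

(* Main.v *)
From HB Require Import structures.
Require Import Defs.
From mathcomp Require Import all_boot all_order all_algebra all_fingroup.
From mathcomp Require Import zify.
From Corelib Require Import PosDef.

(* A permutation pi of [n] is sent to the perfect matching of [2n] with       *)
(* blocks {i, n + pi_i}.  A copy of the matching of tau inside that of pi     *)
(* uses whole blocks, since all blocks have two elements; its left endpoints  *)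
(* lie in [n] and its right endpoints beyond n, so it is a choice of entries  *)
(* of pi ordered like those of tau.                                           *)
(* The matching is printed in quadratic time: a first pass over pi counts n   *)
(* in a binary counter, and a second pass prints, for each entry, a counter i *)
(* followed by the sum n + pi_i, formed bit by bit.                           *)

Set Implicit Arguments.
Unset Strict Implicit.
Unset Printing Implicit Defensive.

(** * Binary arithmetic, least significant bit first *)

(** The reduction sends each permutation to its matching. By [part_containsE], containment of
    partitions is the existence of an increasing map that preserves and reflects lying in a common
    block. Between matchings such a map carries pairs to pairs and left endpoints to left endpoints,
    since the left endpoint is the smaller one of its block. Order on left endpoints then says that
    positions increase, and order on right endpoints that values compare alike: this is
    [matching_contains].

    For the running time, [reduction_machine_correct] follows a four-tape machine. Its counters
    never exceed the number of entries, so each entry costs a number of steps linear in the input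
    length, and the total is quadratic. [enc_part_matching] identifies the printed word with the
    encoding of the matching, because the minima of the blocks are exactly the left endpoints. *)

Fixpoint bits_inc (c : bool) (bs : seq bool) : seq bool :=
  if bs is b :: bs' then (b (+) c) :: bits_inc (c && b) bs'
  else if c then [:: true] else [::].

Definition majority (a b c : bool) : bool := (a && b) || (c && (a || b)).

Fixpoint bits_add (c : bool) (xs ys : seq bool) : seq bool :=
  match xs, ys with
  | [::], _ => bits_inc c ys
  | _, [::] => bits_inc c xs
  | x :: xs', y :: ys' => (x (+) y (+) c) :: bits_add (majority x y c) xs' ys'
  end.

Lemma bits_inc_false bs : bits_inc false bs = bs.
Proof. by elim: bs => //= b bs ->; rewrite addbF. Qed.

Lemma pos_bits_succ p : pos_bits (Pos.succ p) = bits_inc true (pos_bits p).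
Proof. by elim: p => //= p IHp; rewrite ?IHp // bits_inc_false. Qed.

Lemma bits_adds0 c xs : bits_add c xs [::] = bits_inc c xs.
Proof. by case: xs. Qed.

(** The two claims are proved together because [Pos.add] and [Pos.add_carry] call each other. *)
Lemma pos_bits_add p q :
  pos_bits (Pos.add p q) = bits_add false (pos_bits p) (pos_bits q) /\
  pos_bits (Pos.add_carry p q) = bits_add true (pos_bits p) (pos_bits q).
Proof.
by elim: p q => [p IHp|p IHp|] [q|q|] //=;
  rewrite ?(IHp q).1 ?(IHp q).2 ?pos_bits_succ ?bits_adds0 ?bits_inc_false.
Qed.

Lemma nat_bitsS n : nat_bits n.+1 = bits_inc true (nat_bits n).
Proof.
rewrite /nat_bits -{1}(bin_of_natK n); case: (bin_of_nat n) => // p.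
by rewrite [nat_of_bin _]/= -nat_of_succ_pos (nat_of_binK (Npos _)) pos_bits_succ.
Qed.

Lemma nat_bitsD m n : nat_bits (m + n) = bits_add false (nat_bits m) (nat_bits n).
Proof.
rewrite /nat_bits -{1}(bin_of_natK m) -{1}(bin_of_natK n).
case: (bin_of_nat m) (bin_of_nat n) => [|p] [|q] //=;
  rewrite ?add0n ?addn0 ?bits_inc_false ?(nat_of_binK (Npos _)) //.
  by case: (pos_bits p) => //= b bs; rewrite addbF bits_inc_false.
by rewrite -nat_of_add_pos (nat_of_binK (Npos _)) (pos_bits_add p q).1.
Qed.

Lemma size_bits_inc c bs : size (bits_inc c bs) <= size bs + c.
Proof.
elim: bs c => [[]//|b bs IHbs] c /=.
by rewrite addSn ltnS (leq_trans (IHbs _)) // leq_add2l; case: c; case: b.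
Qed.

(** This crude bound suffices for a quadratic running time, as the counters are bounded by the input
    length. *)
Lemma size_nat_bits n : size (nat_bits n) <= n.
Proof.
elim: n => // n IHn; rewrite nat_bitsS (leq_trans (size_bits_inc _ _)) //.
by rewrite addn1.
Qed.

(** * The machine *)

(** [Mark] and [Open] set both counters to zero, [Scan] is the counting pass, [Rewind] returns to
    the first entry, and [Next] chooses between an entry, the separator and the end. [Close]
    restores the end symbol after an increment. [Add c] prints the sum with carry [c]; [Back None]
    follows it and ends the block. *)
Inductive state :=
  | Mark | Open | Scan
  | Inc of bool & bool
  | Close of bool
  | Back of option bool
  | Rewind | Next
  | Add of bool
  | Halt.

Definition state_code (q : state) : 'I_6 + (bool * bool + bool + option bool + bool) :=
  match q with
  | Mark => inl (inord 0) | Open => inl (inord 1) | Scan => inl (inord 2)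
  | Rewind => inl (inord 3) | Next => inl (inord 4) | Halt => inl (inord 5)
  | Inc b c => inr (inl (inl (inl (b, c))))
  | Close b => inr (inl (inl (inr b)))
  | Back r => inr (inl (inr r))
  | Add c => inr (inr c)
  end.

Definition state_decode (x : 'I_6 + (bool * bool + bool + option bool + bool)) :=
  match x with
  | inl i => nth Halt [:: Mark; Open; Scan; Rewind; Next; Halt] i
  | inr (inl (inl (inl (b, c)))) => Inc b c
  | inr (inl (inl (inr b))) => Close b
  | inr (inl (inr r)) => Back r
  | inr (inr c) => Add c
  end.

Lemma state_codeK : cancel state_code state_decode.
Proof. by case=> //=; rewrite inordK. Qed.

HB.instance Definition _ := Finite.copy state (can_type state_codeK).

Notation symbol := (cell sym void).
Notation action := (symbol * direction)%type.

Definition ltr (a : sym) : symbol := Some (inl a).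

Definition bit_of (x : symbol) : option bool :=
  if x is Some (inl (Bit b)) then Some b else None.

(* The tapes hold the input, the size n of the permutation being read, the    *)
(* index i of its current entry, and the output.  [Inc b] increments i and    *)
(* prints it if b, and increments n otherwise; [Back] returns to the start of *)
(* a counter.                                                                 *)
Definition transition (q : state) (x n i o : symbol) :
    state * action * action * action * action :=
  match q with
  | Mark => (Open, (x, Stay), (ltr Separator, MoveRight),
                   (ltr Separator, MoveRight), (o, Stay))
  | Open => (Scan, (x, Stay), (ltr EndNumber, Stay),
                   (ltr EndNumber, Stay), (o, Stay))
  | Scan =>
    match x with
    | Some (inl (Bit _)) =>
      (Scan, (x, MoveRight), (n, Stay), (i, Stay), (o, Stay))
    | Some (inl EndNumber) =>
      (Inc false true, (x, MoveRight), (n, Stay), (i, Stay), (o, Stay))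
    | _ => (Rewind, (x, MoveLeft), (n, Stay), (i, Stay), (o, Stay))
    end
  | Inc b c =>
    match bit_of (if b then i else n), c with
    | Some d, _ =>
      let a := (ltr (Bit (d (+) c)), MoveRight) in
      (Inc b (c && d), (x, Stay), (if b then (n, Stay) else a),
       (if b then a else (i, Stay)), (if b then a else (o, Stay)))
    | None, true =>
      let a := (ltr (Bit true), MoveRight) in
      (Close b, (x, Stay), (if b then (n, Stay) else a),
       (if b then a else (i, Stay)), (if b then a else (o, Stay)))
    | None, false =>
      (Close b, (x, Stay), (n, Stay), (i, Stay), (o, Stay))
    end
  | Close b =>
    let a := (ltr EndNumber, MoveLeft) in
    (Back (Some b), (x, Stay), (if b then (n, Stay) else a),
     (if b then a else (i, Stay)),
     (if b then (ltr EndNumber, MoveRight) else (o, Stay)))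
  | Back (Some true) =>
    if bit_of i is Some _
    then (Back (Some true), (x, Stay), (n, Stay), (i, MoveLeft), (o, Stay))
    else (Add false, (x, Stay), (n, Stay), (i, MoveRight), (o, Stay))
  | Back (Some false) =>
    if bit_of n is Some _
    then (Back (Some false), (x, Stay), (n, MoveLeft), (i, Stay), (o, Stay))
    else (Scan, (x, Stay), (n, MoveRight), (i, Stay), (o, Stay))
  | Back None =>
    if bit_of n is Some _
    then (Back None, (x, Stay), (n, MoveLeft), (i, Stay), (o, Stay))
    else (Next, (x, Stay), (n, MoveRight), (i, Stay), (ltr EndBlock, MoveRight))
  | Rewind =>
    match x with
    | Some (inl (Bit _)) | Some (inl EndNumber) =>
      (Rewind, (x, MoveLeft), (n, Stay), (i, Stay), (o, Stay))
    | _ => (Next, (x, MoveRight), (n, Stay), (i, Stay), (o, Stay))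
    end
  | Next =>
    match x with
    | Some (inl Separator) =>
      (Mark, (x, MoveRight), (n, Stay), (i, Stay), (ltr Separator, MoveRight))
    | Some _ => (Inc true true, (x, Stay), (n, Stay), (i, Stay), (o, Stay))
    | None => (Halt, (x, Stay), (n, Stay), (i, Stay), (o, Stay))
    end
  | Add c =>
    match bit_of x, bit_of n, c with
    | Some a, Some b, _ =>
      (Add (majority a b c), (x, MoveRight), (n, MoveRight), (i, Stay),
       (ltr (Bit (a (+) b (+) c)), MoveRight))
    | Some a, None, _ =>
      (Add (c && a), (x, MoveRight), (n, Stay), (i, Stay),
       (ltr (Bit (a (+) c)), MoveRight))
    | None, Some b, _ =>
      (Add (c && b), (x, Stay), (n, MoveRight), (i, Stay),
       (ltr (Bit (b (+) c)), MoveRight))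
    | None, None, true =>
      (Add false, (x, Stay), (n, Stay), (i, Stay), (ltr (Bit true), MoveRight))
    | None, None, false =>
      (Back None, (x, MoveRight), (n, MoveLeft), (i, Stay),
       (ltr EndNumber, MoveRight))
    end
  | Halt => (Halt, (x, Stay), (n, Stay), (i, Stay), (o, Stay))
  end.

Definition reduction_delta (q : state) (g : {ffun 'I_4 -> symbol}) :
    state * {ffun 'I_4 -> action} :=
  let: (q', a, b, c, d) := transition q (g (inord 0)) (g (inord 1))
                                        (g (inord 2)) (g (inord 3)) in
  (q', [ffun i : 'I_4 => nth a [:: a; b; c; d] i]).

Definition halted (q : state) : bool := if q is Halt then true else false.

Definition reduction_machine : machine sym :=
  @Machine sym void 3 state Mark halted reduction_delta.

(** * Configurations with four explicit tapes *)

Notation snapshot :=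
  (state * tape symbol * tape symbol * tape symbol * tape symbol)%type.

Definition snapshot_step (s : snapshot) : snapshot :=
  let: (q, X, N, K, W) := s in
  let: (q', a, b, c, d) := transition q (tape_head X) (tape_head N)
                                        (tape_head K) (tape_head W) in
  if halted q then s else
  (q', tape_update None X a, tape_update None N b, tape_update None K c,
   tape_update None W d).

(** The tapes of a configuration form a function, so they are compared pointwise, which avoids
    functional extensionality. *)
Definition represents (c : config reduction_machine) (s : snapshot) : Prop :=
  let: (q, X, N, K, W) := s in
  conf_state c = q /\
  forall i : 'I_4, conf_tapes c i = nth X [:: X; N; K; W] i.

Lemma represents_step c s :
  represents c s -> represents (step c) (snapshot_step s).
Proof.
case: s => [[[[q X] N] K] W] [cq ct]; rewrite /step /snapshot_step cq.
rewrite [mach_delta _]/= /reduction_delta !ffunE !ct !inordK //=.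
case: (transition _ _ _ _ _) => [[[[q' a] b] c'] d] /=.
case: ifP => // _; split=> // i; rewrite /= ct ffunE.
by case: i => [[|[|[|[|]]]]].
Qed.

Lemma represents_iter t c s :
  represents c s -> represents (iter t (@step _ _) c) (iter t snapshot_step s).
Proof. by move=> ?; elim: t => //= t IHt; apply: represents_step. Qed.

(** * Reachability within a bounded number of steps *)

Definition reach (k : nat) (s s' : snapshot) : Prop :=
  exists2 t, t <= k & iter t snapshot_step s = s'.

Lemma reach_refl k s : reach k s s.
Proof. by exists 0. Qed.

Lemma reach_trans k1 k2 s1 s2 s3 :
  reach k1 s1 s2 -> reach k2 s2 s3 -> reach (k1 + k2) s1 s3.
Proof.
move=> [t1 le1 <-] [t2 le2 <-]; exists (t2 + t1); last by rewrite iterD.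
by rewrite addnC leq_add.
Qed.

Lemma reach_step k s s' : reach k (snapshot_step s) s' -> reach k.+1 s s'.
Proof. by case=> t le_tk <-; exists t.+1 => //; rewrite iterSr. Qed.

Lemma reach_weaken k k' s s' : k <= k' -> reach k s s' -> reach k' s s'.
Proof. by move=> le_k [t le_t <-]; exists t => //; apply: leq_trans le_k. Qed.

(* The head is on the first cell of R, and L is listed from the head outwards. *)
Definition mk (L R : seq symbol) : tape symbol :=
  Tape L (head None R) (behead R).

Definition bits (bs : seq bool) : seq symbol := [seq ltr (Bit b) | b <- bs].

(* Whatever lies beyond the marker and the end symbol of a counter is junk. *)
Definition counter (n : nat) (t : tape symbol) : Prop :=
  exists L J, t = mk (ltr Separator :: L)
                     (bits (nat_bits n) ++ ltr EndNumber :: J).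

(** * Operations on the counters *)

Lemma bits_rcons bs b : bits (rcons bs b) = rcons (bits bs) (ltr (Bit b)).
Proof. exact: map_rcons. Qed.

Lemma rev_bits_cons b bs A : rev (bits (b :: bs)) ++ A = rev (bits bs) ++ ltr (Bit b) :: A.
Proof. by rewrite /bits /= rev_cons cat_rcons. Qed.

(** If the carry lengthens the counter, the new bit overwrites the end symbol and [J'] is [J];
    otherwise [J'] still starts with the end symbol. [Close] writes it in both cases. *)
Lemma reach_inc_n c bs A J X K W : exists J',
  reach (size bs).+1
    (Inc false c, X, mk A (bits bs ++ ltr EndNumber :: J), K, W)
    (Close false, X, mk (rev (bits (bits_inc c bs)) ++ A) J', K, W).
Proof.
(* Once the idle tapes are destructed, updating them by [Stay] reduces to the same tape. *)
move: X K W => [? ? ?] [? ? ?] [? ? ?].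
elim: bs c A => [|b bs IHbs] c A.
  by case: c; [exists J | exists (ltr EndNumber :: J)];
    apply: reach_step; apply: reach_refl.
have [J' IH] := IHbs (c && b) (ltr (Bit (b (+) c)) :: A).
by exists J'; apply: reach_step; rewrite rev_bits_cons; exact: IH.
Qed.

Lemma reach_inc_i c bs A J X N W : exists J',
  reach (size bs).+1
    (Inc true c, X, N, mk A (bits bs ++ ltr EndNumber :: J), mk W [::])
    (Close true, X, N, mk (rev (bits (bits_inc c bs)) ++ A) J',
     mk (rev (bits (bits_inc c bs)) ++ W) [::]).
Proof.
move: X N => [? ? ?] [? ? ?].
elim: bs c A W => [|b bs IHbs] c A W.
  by case: c; [exists J | exists (ltr EndNumber :: J)];
    apply: reach_step; apply: reach_refl.
have [J' IH] := IHbs (c && b) (ltr (Bit (b (+) c)) :: A) (ltr (Bit (b (+) c)) :: W).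
by exists J'; apply: reach_step; rewrite !rev_bits_cons; exact: IH.
Qed.

(** The tape just after a move to the left: the head is on the first cell of [A], or on a blank if
    [A] is empty, with [R] to its right. *)
Definition mk_left (A R : seq symbol) : tape symbol :=
  mk (behead A) (head None A :: R).

(** The flag [r] tells a return after a sum, which also ends the block, from a return after an
    increment. *)
Lemma reach_back_n bs L R X K W (r : bool) :
  reach (size bs).+1
    (Back (if r then None else Some false), X,
     mk_left (rev (bits bs) ++ ltr Separator :: L) R, K, mk W [::])
    (if r then Next else Scan, X, mk (ltr Separator :: L) (bits bs ++ R), K,
     mk (if r then ltr EndBlock :: W else W) [::]).
Proof.
move: X K => [? ? ?] [? ? ?].
(* The head walks leftwards, so the last bit is met first. *)
elim/last_ind: bs R => [|bs b IHbs] R.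
  by apply: reach_step; case: r; apply: reach_refl.
rewrite size_rcons bits_rcons rev_rcons cat_rcons.
by apply: reach_step; case: r IHbs => IHbs; apply: IHbs.
Qed.

Lemma reach_back_i bs L R X N W :
  reach (size bs).+1
    (Back (Some true), X, N,
     mk_left (rev (bits bs) ++ ltr Separator :: L) R, W)
    (Add false, X, N, mk (ltr Separator :: L) (bits bs ++ R), W).
Proof.
move: X N W => [? ? ?] [? ? ?] [? ? ?].
elim/last_ind: bs R => [|bs b IHbs] R.
  by apply: reach_step; apply: reach_refl.
rewrite size_rcons bits_rcons rev_rcons cat_rcons.
by apply: reach_step; apply: IHbs.
Qed.

Lemma reach_increment_n n N X K W : counter n N ->
  exists2 N', counter n.+1 N' &
    reach (n.*2 + 4) (Inc false true, X, N, K, mk W [::])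
                     (Scan, X, N', K, mk W [::]).
Proof.
case=> L [J ->].
have [J' run_inc] :=
  reach_inc_n true (nat_bits n) (ltr Separator :: L) J X K (mk W [::]).
rewrite -nat_bitsS in run_inc.
exists (mk (ltr Separator :: L)
           (bits (nat_bits n.+1) ++ ltr EndNumber :: behead J')).
  by exists L, (behead J').
(* A sweep over the old value, then one step for [Close] and a sweep back over the new value. *)
apply: (@reach_weaken ((size (nat_bits n)).+1 + (size (nat_bits n.+1)).+2)).
  by have := size_nat_bits n; have := size_nat_bits n.+1; lia.
apply: reach_trans run_inc _; apply: reach_step.
move: (X) (K) => [? ? ?] [? ? ?].
exact: (@reach_back_n _ L (ltr EndNumber :: behead J') _ _ W false).
Qed.

Lemma map_enc_nat m (R : seq symbol) :
  map ltr (enc_nat m) ++ R = bits (nat_bits m) ++ ltr EndNumber :: R.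
Proof. by rewrite /enc_nat map_rcons cat_rcons -map_comp. Qed.

Lemma rev_map_enc_nat m (R : seq symbol) :
  rev (map ltr (enc_nat m)) ++ R =
  ltr EndNumber :: rev (bits (nat_bits m)) ++ R.
Proof. by rewrite /enc_nat map_rcons rev_rcons -map_comp. Qed.

Lemma reach_increment_i i K X N W : counter i K ->
  exists2 K', counter i.+1 K' &
    reach (i.*2 + 4) (Inc true true, X, N, K, mk W [::])
      (Add false, X, N, K', mk (rev (map ltr (enc_nat i.+1)) ++ W) [::]).
Proof.
case=> L [J ->].
have [J' run_inc] :=
  reach_inc_i true (nat_bits i) (ltr Separator :: L) J X N W.
rewrite -nat_bitsS in run_inc.
exists (mk (ltr Separator :: L)
           (bits (nat_bits i.+1) ++ ltr EndNumber :: behead J')).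
  by exists L, (behead J').
apply: (@reach_weaken ((size (nat_bits i)).+1 + (size (nat_bits i.+1)).+2)).
  by have := size_nat_bits i; have := size_nat_bits i.+1; lia.
apply: reach_trans run_inc _; apply: reach_step; rewrite rev_map_enc_nat.
move: (X) (N) => [? ? ?] [? ? ?].
exact: (@reach_back_i _ L (ltr EndNumber :: behead J')).
Qed.

(** Every step consumes a bit of at least one number, except for a possible final carry and the end
    symbol; these give the 2 in the bound. *)
Lemma reach_add c xs ys A R B J K W :
  reach (size xs + size ys + 2)
    (Add c, mk A (bits xs ++ ltr EndNumber :: R),
     mk B (bits ys ++ ltr EndNumber :: J), K, mk W [::])
    (Back None, mk (ltr EndNumber :: rev (bits xs) ++ A) R,
     mk_left (rev (bits ys) ++ B) (ltr EndNumber :: J), K,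
     mk (ltr EndNumber :: rev (bits (bits_add c xs ys)) ++ W) [::]).
Proof.
move: K => [? ? ?].
elim: xs ys c A B W => [|x xs IHxs] ys c A B W.
  (* The entry is exhausted, and the carry runs through the rest of the counter. *)
  elim: ys c B W => [|y ys IHys] c B W.
    by case: c; [do 2!apply: reach_step | apply: reach_step]; apply: reach_refl.
  by apply: reach_step; rewrite !rev_bits_cons; apply: IHys.
case: ys => [|y ys]; rewrite /= !rev_bits_cons !addSn; apply: reach_step.
  by have := IHxs [::] (c && x); rewrite bits_adds0; apply.
apply: (@reach_weaken (size xs + size ys + 2)); first lia.
exact: (IHxs ys (majority x y c)).
Qed.

(** * Passes over a permutation *)

Definition numbers_word (ms : seq nat) : seq symbol :=
  map ltr (flatten (map enc_nat ms)).

Lemma numbers_word_cons m ms R :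
  numbers_word (m :: ms) ++ R =
  bits (nat_bits m) ++ ltr EndNumber :: (numbers_word ms ++ R).
Proof. by rewrite /numbers_word /= map_cat -catA map_enc_nat. Qed.

Lemma rev_numbers_word_cons m ms A :
  rev (numbers_word (m :: ms)) ++ A =
  rev (numbers_word ms) ++ ltr EndNumber :: rev (bits (nat_bits m)) ++ A.
Proof. by rewrite /numbers_word /= map_cat rev_cat -catA rev_map_enc_nat. Qed.

Lemma size_numbers_word_cons m ms :
  size (numbers_word (m :: ms)) =
  (size (nat_bits m) + size (numbers_word ms)).+1.
Proof. by rewrite /numbers_word /= !size_map size_cat size_rcons size_map. Qed.

(** Each number has its own end symbol. This turns bounds in the number of entries into bounds in
    the input length. *)
Lemma size_le_numbers_word ms : size ms <= size (numbers_word ms).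
Proof.
elim: ms => // m ms IHms; rewrite size_numbers_word_cons [size (_ :: _)]/= ltnS.
exact: leq_trans IHms (leq_addl _ _).
Qed.

Lemma reach_scan_number bs A R N K W :
  reach (size bs).+1
    (Scan, mk A (bits bs ++ ltr EndNumber :: R), N, K, W)
    (Inc false true, mk (ltr EndNumber :: rev (bits bs) ++ A) R, N, K, W).
Proof.
move: N K W => [? ? ?] [? ? ?] [? ? ?].
elim: bs A => [|b bs IHbs] A; first by apply: reach_step; apply: reach_refl.
by apply: reach_step; rewrite rev_bits_cons; apply: IHbs.
Qed.

(** [S] bounds the counter throughout the pass, so that all increments share one cost. *)
Lemma reach_scan ms S n N A R K W : counter n N -> n + size ms <= S ->
  exists2 N', counter (n + size ms) N' &
    reach (size (numbers_word ms) + size ms * (S.*2 + 4))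
      (Scan, mk A (numbers_word ms ++ R), N, K, mk W [::])
      (Scan, mk (rev (numbers_word ms) ++ A) R, N', K, mk W [::]).
Proof.
elim: ms n N A => [|m ms IHms] n N A cN leS.
  by exists N; [rewrite addn0 | apply: reach_refl].
rewrite numbers_word_cons rev_numbers_word_cons size_numbers_word_cons.
set A' := _ :: rev _ ++ A.
have [N1 cN1 run1] :=
  reach_increment_n (mk A' (numbers_word ms ++ R)) K W cN.
have [||N2 cN2 run2] := IHms n.+1 N1 A'; rewrite //= in leS *; first lia.
exists N2; first by rewrite -addSnnS.
have run0 := reach_scan_number (nat_bits m) A (numbers_word ms ++ R) N K (mk W [::]).
apply: reach_weaken (reach_trans run0 (reach_trans run1 run2)).
by set s := size (numbers_word ms); nia.
Qed.

Definition numeric (x : symbol) : bool :=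
  match x with
  | Some (inl (Bit _)) | Some (inl EndNumber) => true
  | _ => false
  end.

Lemma numeric_numbers_word ms : all numeric (numbers_word ms).
Proof.
elim: ms => //= m ms IHms; have := numbers_word_cons m ms [::].
rewrite !cats0 => ->; rewrite all_cat /= IHms andbT.
by elim: (nat_bits m).
Qed.

(** The head stops at the first cell that is not [numeric]: a blank before the first permutation,
    the separator before the second. If [A] is empty, this blank becomes an explicit cell, whence
    [head None A :: behead A]. *)
Lemma reach_rewind w A R N K W :
    all numeric w -> ~~ numeric (head None A) ->
  reach (size w).+1
    (Rewind, mk_left (rev w ++ A) R, N, K, W)
    (Next, mk (head None A :: behead A) (w ++ R), N, K, W).
Proof.
move: N K W => [? ? ?] [? ? ?] [? ? ?].
elim/last_ind: w R => [|w x IHw] R wP AP.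
  apply: reach_step; move: AP.
  by case: A => [|[[[]|[]]|] A] //= _; apply: reach_refl.
move: wP; rewrite all_rcons => /andP[xP wP].
rewrite rev_rcons size_rcons cat_rcons; apply: reach_step.
have := IHw (x :: R) wP AP.
by case: x xP => [[[]|[]]|].
Qed.

(** The word printed for the entries [ms] that follow the first [i] ones; the entries are counted
    from 1, so the right endpoint is their sum with [n]. *)
Fixpoint blocks_word (n i : nat) (ms : seq nat) : seq sym :=
  if ms is m :: ms' then
    enc_nat i.+1 ++ enc_nat (m + n) ++ EndBlock :: blocks_word n i.+1 ms'
  else [::].

Lemma reach_blocks ms S n i N A R K W :
    counter n N -> counter i K -> n <= S -> i + size ms <= S ->
  exists K', reach (size (numbers_word ms) + size ms * (4 * S + 8))
    (Next, mk A (numbers_word ms ++ R), N, K, mk W [::])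
    (Next, mk (rev (numbers_word ms) ++ A) R, N, K',
     mk (rev (map ltr (blocks_word n i ms)) ++ W) [::]).
Proof.
move=> cN; elim: ms i K A W => [|m ms IHms] i K A W cK le_n le_i.
  by exists K; apply: reach_refl.
rewrite numbers_word_cons rev_numbers_word_cons size_numbers_word_cons.
set A' := _ :: rev _ ++ A; set X := mk A _.
have [K1 cK1 run1] := reach_increment_i X N W cK.
case: (cN) => L [J defN].
set W1 := rev _ ++ W in run1.
have run2 := reach_add false (nat_bits m) (nat_bits n) A
  (numbers_word ms ++ R) (ltr Separator :: L) J K1 W1.
rewrite -nat_bitsD -(rev_map_enc_nat (m + n)) -/A' in run2.
set W2 := rev (map ltr (enc_nat (m + n))) ++ W1 in run2.
have run3 := @reach_back_n (nat_bits n) L (ltr EndNumber :: J)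
  (mk A' (numbers_word ms ++ R)) K1 W2 true.
rewrite -defN /= in run2 run3 le_i *.
have [|K2 run4] := IHms i.+1 K1 A' (ltr EndBlock :: W2) cK1 le_n; first lia.
have run0 : reach 1 (Next, X, N, K, mk W [::]) (Inc true true, X, N, K, mk W [::]).
  move: (N) (K) => [? ? ?] [? ? ?]; apply: reach_step; rewrite /X.
  by case: (nat_bits m) => *; apply: reach_refl.
exists K2; rewrite !map_cat /= !rev_cat rev_cons -!catA cat_rcons.
apply: reach_weaken (reach_trans run0 (reach_trans run1
  (reach_trans run2 (reach_trans run3 run4)))).
(* Besides its own bits, an entry costs at most 2i + 4 for the increment, two sweeps over [n], and 4
   further steps. *)
by have := size_nat_bits n; set s := size (numbers_word ms); nia.
Qed.

(** It is used for both permutations: [N] and [K] are arbitrary since fresh counters are opened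
    wherever the heads stand. The bound adds 2 steps of setup, the counting pass, 1 step to turn,
    the rewinding and the printing pass. *)
Lemma reach_part ms A R N K W :
    ~~ numeric (head None A) -> ~~ numeric (head None R) ->
  let s := size (numbers_word ms) in
  exists N' K', reach (6 * s * s + 15 * s + 4)
    (Mark, mk A (numbers_word ms ++ R), N, K, mk W [::])
    (Next, mk (rev (numbers_word ms) ++ head None A :: behead A)
              (head None R :: behead R), N', K',
     mk (rev (map ltr (blocks_word (size ms) 0 ms)) ++ W) [::]).
Proof.
move=> AP RP s.
(* The effect of [Mark] and [Open]: zero has no bits, so its end symbol directly follows the
   marker. *)
pose empty (t : tape symbol) := mk (ltr Separator :: tape_left t)
  (ltr EndNumber :: behead (tape_right t)).
have c0 t : counter 0 (empty t) by exists (tape_left t), (behead (tape_right t)).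
have [N1 cN1 run1] := @reach_scan ms (size ms) 0 _ A R (empty K) W (c0 N) (leqnn _).
have run0 : reach 2 (Mark, mk A (numbers_word ms ++ R), N, K, mk W [::])
    (Scan, mk A (numbers_word ms ++ R), empty N, empty K, mk W [::]).
  by do 2!apply: reach_step; apply: reach_refl.
set A' := rev _ ++ A in run1.
have run2 : reach 1 (Scan, mk A' R, N1, empty K, mk W [::])
    (Rewind, mk_left A' (head None R :: behead R), N1, empty K, mk W [::]).
  move: (N1) => [? ? ?]; apply: reach_step; move: RP.
  by case: R {run0 run1} => [|[[[]|[]]|] R] //= _; apply: reach_refl.
have run3 := reach_rewind (head None R :: behead R) N1 (empty K) (mk W [::])
  (numeric_numbers_word ms) AP.
have [K1 run4] := reach_blocks (head None A :: behead A)
  (head None R :: behead R) W cN1 (c0 K) (leqnn _) (leqnn _).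
exists N1, K1; apply: reach_weaken (reach_trans run0 (reach_trans run1
  (reach_trans run2 (reach_trans run3 run4)))).
by have := size_le_numbers_word ms; rewrite -/s add0n; nia.
Qed.

Lemma reduction_machine_correct ms ms' :
  let w := flatten (map enc_nat ms) ++ Separator :: flatten (map enc_nat ms') in
  exists t, t <= 12 * (size w * size w) + 30 * size w + 10 /\
    halts_with reduction_machine w
      (blocks_word (size ms) 0 ms ++
       Separator :: blocks_word (size ms') 0 ms') t.
Proof.
move=> w.
pose X := mk [::] (numbers_word ms ++ ltr Separator :: numbers_word ms' ++ [::]).
have [N1 [K1 run1]] := @reach_part ms [::]
  (ltr Separator :: numbers_word ms' ++ [::]) (mk [::] [::]) (mk [::] [::]) [::]
  isT isT.
rewrite /= in run1; set A1 := rev _ ++ _ in run1; set W1 := rev _ ++ _ in run1.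
have [N2 [K2 run2]] := @reach_part ms' (ltr Separator :: A1) [::] N1 K1
  (ltr Separator :: W1) isT isT.
rewrite /= in run2; set A2 := rev _ ++ _ in run2; set W2 := rev _ ++ _ in run2.
have sep : reach 1
    (Next, mk A1 (ltr Separator :: numbers_word ms' ++ [::]), N1, K1, mk W1 [::])
    (Mark, mk (ltr Separator :: A1) (numbers_word ms' ++ [::]), N1, K1,
     mk (ltr Separator :: W1) [::]).
  by move: (N1) (K1) => [? ? ?] [? ? ?]; apply: reach_step; apply: reach_refl.
have stop : reach 1 (Next, mk A2 [:: None], N2, K2, mk W2 [::])
                    (Halt, mk A2 [:: None], N2, K2, mk W2 [::]).
  by move: (N2) (K2) => [? ? ?] [? ? ?]; apply: reach_step; apply: reach_refl.
have [t le_t run] := reach_trans run1 (reach_trans sep (reach_trans run2 stop)).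
exists t; split.
  apply: leq_trans le_t _; rewrite /w size_cat /=.
  by rewrite /numbers_word !size_map; nia.
have init : represents (init_config reduction_machine w)
    (Mark, X, mk [::] [::], mk [::] [::], mk [::] [::]).
  split=> // i /=; have -> : input_tape reduction_machine w = X.
    rewrite /X cats0 /numbers_word -[_ :: map _ _]/(map ltr (_ :: _)) -map_cat -/w.
    by case: (w).
  by case: i => [[|[|[|[|]]]]].
have := represents_iter t init; rewrite run /halts_with => -[-> ct]; split=> //.
(* The output head rests on the blank after the last letter, which is the one trailing blank. *)
exists 0, 1; rewrite ct /= /tape_word /= /W2 /W1 cats0.
by rewrite rev_cat rev_cons !revK map_cat /= cat_rcons -catA.
Qed.

(** * Containment of set partitions through increasing maps *)

Definition same_block (s : set_partition) (x y : 'I_(part_size s)) : bool :=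
  y \in pblock (part_blocks s) x.

Definition increasing m n (g : 'I_m -> 'I_n) : Prop :=
  forall x y : 'I_m, x < y -> g x < g y.

Lemma increasing_ltn m n (g : 'I_m -> 'I_n) (x y : 'I_m) :
  increasing g -> (g x < g y) = (x < y).
Proof.
move=> ginc; case: (ltngtP x y) => [/ginc-> //|/ginc|/val_inj->].
  by move=> lt_yx; apply/negbTE; rewrite -leqNgt ltnW.
by rewrite ltnn.
Qed.

Lemma increasing_inj m n (g : 'I_m -> 'I_n) : increasing g -> injective g.
Proof.
move=> ginc x y eq_g; apply: val_inj.
by case: (ltngtP x y) => // /ginc; rewrite eq_g ltnn.
Qed.

Lemma same_blockP (s : set_partition) (B : {set 'I_(part_size s)}) x y :
  B \in part_blocks s -> x \in B -> same_block x y = (y \in B).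
Proof.
case/and3P: (part_blocksP s) => _ tiP _ BP xB.
by rewrite /same_block (def_pblock tiP BP xB).
Qed.

Lemma block_exists (s : set_partition) (x : 'I_(part_size s)) :
  exists2 B, B \in part_blocks s & x \in B.
Proof.
case/and3P: (part_blocksP s) => /eqP covP _ _.
have : x \in cover (part_blocks s) by rewrite covP inE.
by case/bigcupP=> B; exists B.
Qed.

(** A partition is determined by its equivalence relation. The sizes are only propositionally equal,
    so [sub] transports blocks along [cast_ord]; it is applied in both directions before [e] is
    eliminated. *)
Lemma set_partition_ext (s s' : set_partition)
    (e : part_size s = part_size s') :
  (forall x y : 'I_(part_size s),
     same_block x y = same_block (cast_ord e x) (cast_ord e y)) ->
  s = s'.
Proof.
suff sub (t t' : set_partition) (et : part_size t = part_size t') :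
    (forall x y : 'I_(part_size t),
      same_block x y = same_block (cast_ord et x) (cast_ord et y)) ->
    forall B, B \in part_blocks t ->
      [set cast_ord et x | x in B] \in part_blocks t'.
  move=> ext; have ext' (x y : 'I_(part_size s')) :
      same_block x y = same_block (cast_ord (esym e) x) (cast_ord (esym e) y).
    by rewrite ext !cast_ordKV.
  have {ext}s1 := sub _ _ _ ext; have {ext' sub}s2 := sub _ _ _ ext'.
  case: s s' e s1 s2 => [n P hP] [n' P' hP'] /= e; case: n' / e P' hP'.
  move=> P' hP' s1 s2; have id_img (B : {set 'I_n}) (et : n = n) :
      [set cast_ord et x | x in B] = B.
    by rewrite -[RHS]imset_id; apply: eq_imset => x; rewrite cast_ord_id.
  have eqP' : P = P'.
    by apply/setP => B; apply/idP/idP => [/s1|/s2]; rewrite id_img.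
  by case: P' / eqP' hP' {s1 s2} => hP'; rewrite (bool_irrelevance hP hP').
move=> ext B BP.
have /set0Pn[x xB] : B != set0.
  by case/and3P: (part_blocksP t) => _ _; apply: contraNneq => <-.
have [C CP xC] := block_exists (cast_ord et x).
suff -> : [set cast_ord et x | x in B] = C by [].
apply/setP => y; rewrite -(same_blockP _ CP xC) -[y](cast_ordKV et) -ext.
rewrite (same_blockP _ BP xB) mem_imset //; exact: cast_ord_inj.
Qed.

Lemma enum_ord_sorted n (T : {set 'I_n}) :
  sorted (relpre val ltn) (enum T).
Proof.
have srt : sorted (relpre val ltn) (Finite.enum 'I_n).
  by rewrite -enumT -sorted_map val_enum_ord iota_ltn_sorted.
by apply: sorted_filter srt => x y z; apply: ltn_trans.
Qed.

Lemma enum_val_increasing n (T : {set 'I_n}) :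
  increasing (fun i : 'I_#|T| => enum_val i).
Proof.
move=> i j lt_ij; have x0 := enum_val i.
rewrite !(enum_val_nth x0).
by apply: (sorted_ltn_nth _ x0 (enum_ord_sorted T));
  rewrite ?inE -?cardE // => x y z; apply: ltn_trans.
Qed.

Lemma same_block_restrict (s : set_partition) (T : {set 'I_(part_size s)})
    (x y : 'I_#|T|) :
  @same_block (restrict T) x y = same_block (enum_val x) (enum_val y).
Proof.
have [B BP xB] := block_exists (enum_val x).
rewrite (same_blockP _ BP xB) -mem_st_trace; apply: same_blockP.
  rewrite !inE imset_f // andbT; apply/set0Pn; exists x.
  by rewrite mem_st_trace.
by rewrite mem_st_trace.
Qed.

(** Both lists of values are strictly sorted with the same members, hence equal. *)
Lemma increasing_eq m n (g h : 'I_m -> 'I_n) :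
  increasing g -> increasing h -> codom g =i codom h -> g =1 h.
Proof.
move=> ginc hinc eq_gh.
have srt (f : 'I_m -> 'I_n) : increasing f -> sorted (relpre val ltn) (codom f).
  move=> finc; rewrite /codom /image_mem sorted_map.
  apply: (sub_sorted (e := relpre val ltn)) => [x y /=|]; first exact: finc.
  by rewrite -sorted_map val_enum_ord iota_ltn_sorted.
have /eq_in_map eq_f : codom g = codom h.
  apply: (irr_sorted_eq (leT := relpre val ltn)) eq_gh; rewrite ?srt //.
    by move=> x y z; apply: ltn_trans.
  by move=> x /=; rewrite ltnn.
by move=> x; apply: eq_f; rewrite mem_enum.
Qed.

(** A subset [T] corresponds to its increasing enumeration, whose inverse is the standardization;
    conversely [T] is the image of [g]. *)
Lemma part_containsE (s s' : set_partition) :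
  part_contains s s' <->
  exists g : 'I_(part_size s') -> 'I_(part_size s),
    increasing g /\ forall x y, same_block (g x) (g y) = same_block x y.
Proof.
split=> [[T <-]|[g [ginc gP]]].
  exists (fun i => enum_val i); split; first exact: enum_val_increasing.
  by move=> x y; rewrite same_block_restrict.
pose T := [set g x | x in 'I_(part_size s')].
have cT : #|T| = part_size s'.
  by rewrite card_imset ?card_ord //; apply: increasing_inj.
exists T; apply: (@set_partition_ext (restrict T) s' cT) => x y.
rewrite same_block_restrict -gP.
suff eg z : g (cast_ord cT z) = enum_val z by rewrite !eg.
apply: (increasing_eq (g := fun z => g (cast_ord cT z))) => //.
- by move=> ? ? ?; apply: ginc.
- exact: enum_val_increasing.
move=> t; apply/codomP/codomP => [[a ->]|[a ->]].
  have aT : g (cast_ord cT a) \in T by apply: imset_f.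
  by exists (enum_rank_in aT (g (cast_ord cT a))); rewrite enum_rankK_in.
have /imsetP[b _ ->] := enum_valP a.
by exists (cast_ord (esym cT) b); rewrite cast_ordKV.
Qed.

(** * Permutations as perfect matchings *)

Definition matching_block n (p : 'S_n) (i : 'I_n) : {set 'I_(n + n)} :=
  [set lshift n i; rshift n (p i)].

Definition matching_blocks n (p : 'S_n) : {set {set 'I_(n + n)}} :=
  [set matching_block p i | i : 'I_n].

Lemma mem_matching_block n (p : 'S_n) i :
  (forall j, (lshift n j \in matching_block p i) = (j == i)) /\
  (forall j, (rshift n j \in matching_block p i) = (j == p i)).
Proof.
by split=> j; rewrite !inE ?eq_lshift ?eq_rshift ?eq_lrshift ?eq_rlshift ?orbF.
Qed.

Lemma matching_blocksP n (p : 'S_n) :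
  partition (matching_blocks p) [set: 'I_(n + n)].
Proof.
apply/and3P; split.
- rewrite eqEsubset subsetT; apply/subsetP => x _; apply/bigcupP.
  case: (split_ordP x) => j ->.
    by exists (matching_block p j); rewrite ?imset_f ?(mem_matching_block p j).1.
  exists (matching_block p (p^-1%g j)); first by rewrite imset_f.
  by rewrite (mem_matching_block p _).2 permKV.
- apply/trivIsetP => _ _ /imsetP[i _ ->] /imsetP[j _ ->] neq_ij.
  rewrite -setI_eq0; apply/eqP/setP => x; rewrite inE in_set0.
  apply/negP => /andP[]; case: (split_ordP x) => k ->;
    rewrite ?(mem_matching_block p _).1 ?(mem_matching_block p _).2;
    move=> /eqP-> /eqP eq_ij; move: neq_ij; first by rewrite eq_ij eqxx.
  by rewrite (perm_inj eq_ij) eqxx.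
- apply/imsetP => -[i _ /setP/(_ (lshift n i))].
  by rewrite (mem_matching_block p i).1 inE eqxx.
Qed.

Definition matching (pi : permutation) : set_partition :=
  SetPartition (matching_blocksP (perm_fun pi)).

Lemma same_block_lshift (pi : permutation) (i : 'I_(Defs.perm_size pi)) y :
  @same_block (matching pi) (lshift _ i) y =
  (y \in matching_block (perm_fun pi) i).
Proof.
by apply: same_blockP; rewrite ?imset_f ?(mem_matching_block _ i).1.
Qed.

Lemma same_block_rshift (pi : permutation) (i : 'I_(Defs.perm_size pi)) y :
  @same_block (matching pi) (rshift _ (perm_fun pi i)) y =
  (y \in matching_block (perm_fun pi) i).
Proof.
by apply: same_blockP; rewrite ?imset_f ?(mem_matching_block _ i).2.
Qed.

Lemma matching_contains (pi tau : permutation) :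
  perm_contains pi tau <-> part_contains (matching pi) (matching tau).
Proof.
rewrite part_containsE; case: pi tau => [n p] [k t].
rewrite /perm_contains /=; split=> [[f [finc fP]]|[g [ginc gP]]].
  (* Left endpoints follow positions and right endpoints follow values: value [t j] goes to the
     value of [p] at [f j]. *)
  pose g (x : 'I_(k + k)) : 'I_(n + n) :=
    match split x with
    | inl j => lshift n (f j)
    | inr j => rshift n (p (f (t^-1%g j)))
    end.
  have gl j : g (lshift k j) = lshift n (f j).
    by rewrite /g -[lshift k j]/(unsplit (inl j)) unsplitK.
  have gr j : g (rshift k (t j)) = rshift n (p (f j)).
    by rewrite /g -[rshift k _]/(unsplit (inr (t j))) unsplitK permK.
  have finj : injective f by apply: increasing_inj.
  have gr' j : g (rshift k j) = rshift n (p (f (t^-1%g j))).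
    by rewrite -gr permKV.
  exists g; split=> x y; case: (split_ordP x) => i ->;
    case: (split_ordP y) => j ->; rewrite ?gl ?gr'.
  - exact: finc.
  - by move=> _; rewrite /=; apply: leq_trans (leq_addr _ _).
  - by rewrite /= ltnNge (leq_trans (ltnW (ltn_ord j))) ?leq_addr.
  - rewrite /= !ltn_add2l => lt_ij.
    by apply/fP; rewrite !permKV.
  - rewrite !same_block_lshift (mem_matching_block _ _).1.
    by rewrite (mem_matching_block _ _).1 (inj_eq finj).
  - rewrite !same_block_lshift (mem_matching_block _ _).2.
    rewrite (mem_matching_block _ _).2 (inj_eq perm_inj) (inj_eq finj) /=.
    by rewrite -(inj_eq (@perm_inj _ t)) permKV.
  - rewrite -{2}(permKV t i) !same_block_rshift.
    by rewrite !(mem_matching_block _ _).1 (inj_eq finj).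
  - rewrite -{2}(permKV t i) !same_block_rshift.
    rewrite !(mem_matching_block _ _).2 (inj_eq perm_inj) (inj_eq finj) permKV.
    exact: (inj_eq perm_inj).
(* Two ordered elements of one block are a left and a right endpoint. *)
have pairP (j : 'I_k) : exists i : 'I_n,
    g (lshift k j) = lshift n i /\ g (rshift k (t j)) = rshift n (p i).
  have : g (rshift k (t j)) \in pblock (matching_blocks p) (g (lshift k j)).
    have := gP (lshift k j) (rshift k (t j)).
    rewrite same_block_lshift (mem_matching_block _ _).2 eqxx.
    by rewrite /same_block => ->.
  have : g (lshift k j) < g (rshift k (t j)).
    by apply: ginc; rewrite /=; apply: leq_trans (leq_addr _ _).
  case: (split_ordP (g (lshift k j))) => a ->.
    rewrite -/(@same_block (matching (Permutation p)) (lshift n a) _).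
    rewrite same_block_lshift !inE => lt_g /orP[/eqP eq_g|/eqP eq_g].
      by move: lt_g; rewrite eq_g ltnn.
    by exists a.
  rewrite -(permKV p a) -/(@same_block (matching (Permutation p)) _ _).
  rewrite same_block_rshift !inE => lt_g /orP[] /eqP eq_g.
    by move: lt_g; rewrite eq_g /= ltnNge (leq_trans (ltnW (ltn_ord _))) ?leq_addr.
  by move: lt_g; rewrite eq_g ltnn.
(* The boolean form of [pairP] allows [xchoose] to produce the map [f]. *)
have pair_b (j : 'I_k) : exists i : 'I_n,
  (g (lshift k j) == lshift n i) && (g (rshift k (t j)) == rshift n (p i)).
  by have [i [-> ->]] := pairP j; exists i; rewrite !eqxx.
pose f j := xchoose (pair_b j).
have fl j : g (lshift k j) = lshift n (f j).
  by have /andP[/eqP] := xchooseP (pair_b j).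
have fr j : g (rshift k (t j)) = rshift n (p (f j)).
  by have /andP[_ /eqP] := xchooseP (pair_b j).
exists f; split=> j j'.
  move=> lt_j; have := ginc (lshift k j) (lshift k j') lt_j.
  by rewrite !fl.
have := increasing_ltn (rshift k (t j)) (rshift k (t j')) ginc.
by rewrite !fr /= !ltn_add2l => ->.
Qed.

(** * Encodings *)

Lemma enum_ordD m n :
  enum 'I_(m + n) = map (@lshift m n) (enum 'I_m) ++ map (@rshift m n) (enum 'I_n).
Proof.
apply: (inj_map val_inj); transitivity (iota 0 (m + n)).
  exact: val_enum_ord.
rewrite map_cat -!map_comp iotaD.
rewrite [0 + m]addnC iotaDl -!val_enum_ord -map_comp.
by congr (_ ++ _); rewrite enumT; apply: eq_map.
Qed.

Lemma enum_matching_block n (p : 'S_n) i :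
  enum (matching_block p i) = [:: lshift n i; rshift n (p i)].
Proof.
rewrite -[RHS]/(map (@lshift n n) [:: i] ++ map (@rshift n n) [:: p i]).
have filter1 (j : 'I_n) : filter (pred1 j) (enum 'I_n) = [:: j].
  by rewrite filter_pred1_uniq ?enum_uniq ?mem_enum.
have -> : enum (matching_block p i) =
    filter (mem (matching_block p i)) (enum 'I_(n + n)) by rewrite enumT.
rewrite enum_ordD; move: (enum 'I_n) filter1 => e filter1.
rewrite filter_cat !filter_map -(filter1 i) -(filter1 (p i)).
congr (_ ++ _); apply: (congr1 (map _)); apply: eq_filter => j.
  exact: (mem_matching_block p i).1.
exact: (mem_matching_block p i).2.
Qed.

Definition entries (pi : permutation) : seq nat :=
  [seq (perm_fun pi i).+1 | i : 'I_(Defs.perm_size pi) <- enum 'I_(Defs.perm_size pi)].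

Lemma enc_perm_entries pi : enc_perm pi = flatten (map enc_nat (entries pi)).
Proof. by rewrite /enc_perm /enc_ords /entries -!map_comp. Qed.

(** The hypothesis makes [s] a run of consecutive indices from [i], a form that passes to tails in
    the induction. *)
Lemma blocks_word_map n i (s : seq 'I_n) (g : 'I_n -> nat) :
  map val s = iota i (size s) ->
  blocks_word n i (map g s) =
  flatten [seq enc_nat j.+1 ++ enc_nat (g j + n) ++ [:: EndBlock] | j : 'I_n <- s].
Proof.
elim: s i => //= j s IHs i [-> /IHs->].
by rewrite -!catA.
Qed.

Lemma enc_part_matching pi :
  enc_part (matching pi) = blocks_word (size (entries pi)) 0 (entries pi).
Proof.
case: pi => n p; rewrite /entries size_map size_enum_ord /=.
rewrite blocks_word_map ?val_enum_ord ?size_enum_ord //.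
rewrite /enc_part /= enum_ordD; move: (enum 'I_n) => e.
rewrite filter_cat !filter_map.
have defl i : pblock (matching_blocks p) (lshift n i) = matching_block p i.
  apply/setP => y; exact: (@same_block_lshift (Permutation p) i y).
have defr i : pblock (matching_blocks p) (rshift n (p i)) = matching_block p i.
  apply/setP => y; exact: (@same_block_rshift (Permutation p) i y).
(* Every left endpoint is the minimum of its block. *)
rewrite (eq_filter (a2 := predT)); last first.
  move=> i /=; rewrite defl; apply/forall_inP => y.
  rewrite !inE => /orP[] /eqP-> //=.
  by apply: leq_trans (leq_addr _ _); apply: ltnW.
(* No right endpoint is a minimum: its partner lies below it. *)
rewrite [X in _ ++ map _ X](eq_filter (a2 := pred0)); last first.
  move=> j /=; rewrite -(permKV p j) defr; apply/forall_inP.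
  move/(_ (lshift n (p^-1%g j))); rewrite (mem_matching_block p _).1 eqxx.
  by move/(_ isT); rewrite /= leqNgt (leq_trans (ltn_ord _)) ?leq_addr.
rewrite filter_predT filter_pred0 cats0 -map_comp; congr flatten.
apply: eq_map => i /=; rewrite defl enum_matching_block /enc_ords /= cats0.
by rewrite rcons_cat -cats1 addSn addnC.
Qed.

Theorem theorem1 :
  exists f : permutation * permutation -> set_partition * set_partition,
    poly_time_computable (enc_pair enc_perm enc_perm)
                         (enc_pair enc_part enc_part) f /\
    (forall pi tau : permutation,
       perm_contains pi tau <->
       part_contains (f (pi, tau)).1 (f (pi, tau)).2).
Proof.
exists (fun u => (matching u.1, matching u.2)); split; last first.
  by move=> pi tau; apply: matching_contains.
exists reduction_machine, (12%:P * ('X * 'X) + 30%:P * 'X + 10%:P)%R => -[pi tau].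
have [t [le_t out]] := reduction_machine_correct (entries pi) (entries tau).
exists t; rewrite /enc_pair /= !enc_part_matching !enc_perm_entries; split=> //.
by rewrite !hornerD !hornerM !hornerX !hornerC.
Qed.
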